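(* Let $N$ be a free $\mathbb{Z}$-module of rank $d$, and let $(\Delta,\{m_i\}_{i=1}^n)$ be a labelled polytope in $(N\otimes\mathbb{R})^\star$ with primitive inward pointing facet normals $\nu_1\otimes1,\ldots,\nu_n\otimes1$, and $[\mu^{-1}(\tau)/K_D]$ its corresponding toric Deligne-Mumford stack. For $z=(z_1,\ldots,z_n)\in\mu^{-1}(\tau)\subset\mathbb{C}^n$, let $N_z\subset N$ denote the submodule generated by $\{m_i\nu_i\mid z_i=0\}$. Then the canonical map $$\mathrm{Tor}(N/N_z)\to K_D,\qquad x+N_z\mapsto\exp(y\otimes\tfrac1m),$$ is an isomorphism onto its image $\mathrm{Stab}(z)$ (the stabilizer of $z$ in $K_D$), where $m$ is the smallest positive integer such that $mx\in N_z$ and $y$ is the unique element of $\mathrm{span}_{\mathbb{Z}}\{e_i\mid z_i=0\}\subset\mathbb{Z}^n$ satisfying $\beta(y)=mx$.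
   Context: $(-)^\star$ denotes $\mathrm{Hom}_{\mathbb{R}}(-,\mathbb{R})$ for real vector spaces; $\mathrm{Tor}$ denotes the torsion submodule; $S^1\cong\mathbb{R}/\mathbb{Z}$; $e_1,\dots,e_n$ is the standard basis of $\mathbb{Z}^n$. A labelled polytope $(\Delta,\{m_i\}_{i=1}^n)$ in $(N\otimes\mathbb{R})^\star$ is a convex simple polytope $\Delta$ (of full dimension $d$), rational with respect to the lattice $N$, with $n$ facets $F_1,\dots,F_n$ labelled by positive integers $m_1,\dots,m_n$. The primitive inward pointing normal to $F_i$ is $\nu_i\otimes1$ with $\nu_i\in N$ primitive. Define $\beta:\mathbb{Z}^n\to N$ by $\beta(e_i)=m_i\nu_i$. Choosing an identification $N\cong\mathbb{Z}^d$, $\beta_{\mathbb{R}}=\beta\otimes\mathbb{R}$ induces $\bar\beta:(S^1)^n=\mathbb{R}^n/\mathbb{Z}^n\to(S^1)^d=\mathbb{R}^d/\mathbb{Z}^d$, and $K_D=\ker\bar\beta\subset(S^1)^n$. The map $\exp:\mathbb{Z}^n\otimes\mathbb{R}\to(S^1)^n$ is the exponential (quotient) map. $K_D$ acts on $\mathbb{C}^n$ through the standard coordinatewise linear action of $(S^1)^n$. Level set (Delzant construction): write $\Delta=\bigcap_{i=1}^n\{x\mid x(\beta(e_i)\otimes1)\ge-c_i\}$ with $c_i\in\mathbb{R}$. Let $\iota:\mathfrak{k}=\ker\beta_{\mathbb{R}}\hookrightarrow\mathbb{R}^n$ be the inclusion of the Lie algebra of $K_D$. Up to a conventional positive normalization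 constant, $\mu:\mathbb{C}^n\to\mathfrak{k}^\star$ is $\mu(z)=\iota^\star(|z_1|^2,\dots,|z_n|^2)$ and $\tau=\iota^\star(c_1,\dots,c_n)$; equivalently $z\in\mu^{-1}(\tau)$ iff there is $x\in\Delta$ with (up to that constant) $|z_i|^2=x(\beta(e_i)\otimes1)+c_i$ for all $i$. *)

(* Defs.v *)
From HB Require Import structures.
From mathcomp Require Import all_boot all_order all_algebra.
From mathcomp Require Export generic_quotient ring_quotient complex.
From mathcomp Require Import all_classical all_reals all_analysis.

Set Implicit Arguments.
Unset Strict Implicit.
Unset Printing Implicit Defensive.

Import Order.TTheory GRing.Theory Num.Theory.
Import numFieldNormedType.Exports.

Local Open Scope classical_set_scope.
Local Open Scope ring_scope.
Local Open Scope quotient_scope.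

(** * Abelian groups *)

Section IntegerSpan.
Variables (M : zmodType) (I : finType) (P : pred I) (v : I -> M).

Definition zspan : {pred M} :=
  fun x => `[< exists a : I -> int, x = \sum_(i | P i) v i *~ a i >].

Lemma zspan_zmod_closed : zmod_closed zspan.
Proof.
split; first by apply/asboolP; exists (fun=> 0); rewrite big1.
move=> x y /asboolP[a ->] /asboolP[b ->]; apply/asboolP.
exists (fun i => a i - b i); rewrite -sumrB.
by apply: eq_bigr => i _; rewrite mulrzBr.
Qed.

HB.instance Definition _ := GRing.isZmodClosed.Build M zspan zspan_zmod_closed.

End IntegerSpan.

Section Torsion.
Variable M : zmodType.

Definition torsion : {pred M} :=
  fun x => `[< exists2 k : nat, (0 < k)%N & x *+ k = 0 >].

Lemma torsion_zmod_closed : zmod_closed torsion.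
Proof.
split; first by apply/asboolP; exists 1%N.
move=> x y /asboolP[k k0 xk] /asboolP[l l0 yl]; apply/asboolP.
exists (k * l)%N; first by rewrite muln_gt0 k0.
by rewrite mulrnBl mulrnA xk mul0rn mulnC mulrnA yl mul0rn subrr.
Qed.

HB.instance Definition _ :=
  GRing.isZmodClosed.Build M torsion torsion_zmod_closed.

Record Tor := MkTor { tor_val :> M; _ : tor_val \in torsion }.
HB.instance Definition _ := [isSub for tor_val].
HB.instance Definition _ := [Choice of Tor by <:].
HB.instance Definition _ := [SubChoice_isSubZmodule of Tor by <:].

End Torsion.
Arguments torsion M : clear implicits.

Definition primitive (M : zmodType) (x : M) : Prop :=
  forall (k : nat) (w : M), x = w *+ k -> k = 1%N.

Definition least_multiple (M : zmodType) (S : {pred M}) (x : M) (k : nat) :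
    Prop :=
  [/\ (0 < k)%N, x *+ k \in S &
      forall l : nat, (0 < l)%N -> x *+ l \in S -> (k <= l)%N].

(** * Convex polytopes *)

Definition dual (R : fieldType) (V : vectType R) := 'Hom(V, R^o).

Section Polytopes.
Variables (R : realType) (V : vectType R).
Implicit Types D F G : set V.

Definition convex_hull (s : seq V) : set V :=
  [set x | exists a : 'I_(size s) -> R,
     [/\ forall j, 0 <= a j, \sum_j a j = 1 & x = \sum_j a j *: s`_j]].

Definition polytope D : Prop := exists s : seq V, D = convex_hull s.

(* [U] is the direction of the affine hull of [F]. *)
Definition is_direction F (U : {vspace V}) : Prop :=
  (forall x y, F x -> F y -> x - y \in U) /\
  (forall W : {vspace V}, (forall x y, F x -> F y -> x - y \in W) ->
     (U <= W)%VS).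

Definition has_dim F (k : nat) : Prop :=
  F !=set0 /\ exists2 U : {vspace V}, is_direction F U & \dim U = k.

Definition face D F : Prop :=
  exists f : dual V, F = [set x | D x /\ forall y, D y -> f x <= f y].

(* Stated with a successor so that a point has no facets. *)
Definition is_facet D F : Prop :=
  face D F /\ exists2 k : nat, has_dim F k & has_dim D k.+1.

Definition is_vertex D (x : V) : Prop := face D [set x].

(* As many facets through each vertex as the dimension of the polytope. *)
Definition simple_polytope D : Prop :=
  polytope D /\
  forall k : nat, has_dim D k -> forall x, is_vertex D x ->
    ([set F | is_facet D F /\ F x] #= `I_k)%card.

End Polytopes.

(** * Labelled polytopes

    A free Z-module [N] of rank [d] comes with an isomorphism
    [phi : N -> Z^d]; through [phi], the space N (x) R is R^d. *)

Section Tensor.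
Variables (R : realType) (d : nat) (N : zmodType) (phi : {additive N -> 'rV[int]_d}).

Definition tens (x : N) (r : R) : 'rV[R]_d := r *: map_mx intr (phi x).

Definition NRdual := dual 'rV[R]_d.

(* Inward pointing: evaluation at x (x) 1 is minimal on D exactly along F. *)
Definition inward_normal (D F : set NRdual) (x : N) : Prop :=
  F = [set p | D p /\ forall q, D q -> p (tens x 1) <= q (tens x 1)].

Definition rational_polytope (D : set NRdual) : Prop :=
  forall F, is_facet D F -> exists x : N, x != 0 /\ inward_normal D F x.

Record labelled_polytope (n : nat) := LabelledPolytope {
  lp_set :> set NRdual;
  lp_facet : 'I_n -> set NRdual;
  lp_label : 'I_n -> nat;
  lp_simple : simple_polytope lp_set;
  lp_full_dim : has_dim lp_set d;
  lp_rational : rational_polytope lp_set;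
  lp_facet_inj : injective lp_facet;
  lp_facetP : forall F, is_facet lp_set F <-> exists i, F = lp_facet i;
  lp_label_gt0 : forall i, (0 < lp_label i)%N
}.

Definition primitive_normals (n : nat) (D : labelled_polytope n)
    (nu : 'I_n -> N) : Prop :=
  forall i, primitive (nu i) /\ inward_normal D (lp_facet D i) (nu i).

End Tensor.

(** * The torus (S^1)^n *)

Section Torus.
Variable R : realType.

Definition Zsub : {pred R} := Num.int.
Lemma Zsub_zmod_closed : zmod_closed Zsub.
Proof. by split=> [|x y]; [exact: rpred0 | exact: rpredB]. Qed.
HB.instance Definition _ := GRing.isZmodClosed.Build R Zsub Zsub_zmod_closed.

Definition circle := Quotient.quot Zsub.
HB.instance Definition _ := GRing.Zmodule.on circle.

Definition torus (n : nat) := 'rV[circle]_n.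
HB.instance Definition _ n := GRing.Zmodule.on (torus n).

Definition texp n (v : 'rV[R]_n) : torus n := map_mx \pi_(Quotient.quot Zsub) v.

Definition trepr n (t : torus n) : 'rV[R]_n :=
  map_mx (fun s : Quotient.quot Zsub => repr s) t.

Lemma treprK n : cancel (@trepr n) (@texp n).
Proof. by move=> t; apply/rowP => i; rewrite !mxE reprK. Qed.

Lemma texp_is_zmod_morphism n : zmod_morphism (@texp n).
Proof. by move=> u v; apply/rowP => i; rewrite !mxE raddfB. Qed.
HB.instance Definition _ n :=
  GRing.isZmodMorphism.Build _ _ (@texp n) (@texp_is_zmod_morphism n).

Lemma texp_eq0 n (v : 'rV[R]_n) :
  texp v = 0 <-> forall i, v 0 i \in Num.int.
Proof.
have pi0 (x : R) : \pi_(Quotient.quot Zsub) x = 0 <-> x \in Num.int.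
  have -> : (x \in Num.int) = (x == 0 %[mod Quotient.quot Zsub]).
    by rewrite -Quotient.idealrBE subr0.
  by rewrite (raddf0 \pi_(Quotient.quot Zsub)); split => /eqP.
split=> [/rowP e i|h]; last by apply/rowP => i; rewrite !mxE; apply/pi0.
by have := e i; rewrite !mxE => /pi0.
Qed.

(* The identification of R/Z with the unit circle, t |-> e^(2 pi i t). *)
Definition circle_val (s : circle) : R[i] :=
  let t : R := repr (s : Quotient.quot Zsub) in
  (cos (2 * pi * t) +i* sin (2 * pi * t))%C.

Definition torus_act n (t : torus n) (z : 'rV[R[i]]_n) : 'rV[R[i]]_n :=
  \row_i (circle_val (t 0 i) * z 0 i).

End Torus.

(** * The group K_D and the level set *)

Section Delzant.
Variables (R : realType) (d n : nat) (N : zmodType).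
Variables (phi : {additive N -> 'rV[int]_d}) (nu : 'I_n -> N) (m : 'I_n -> nat).

Definition stdZ (i : 'I_n) : 'rV[int]_n := delta_mx 0 i.

Definition tensZ (y : 'rV[int]_n) (r : R) : 'rV[R]_n := r *: map_mx intr y.

Definition beta (y : 'rV[int]_n) : N := \sum_i (nu i *+ m i) *~ y 0 i.

Lemma beta_is_zmod_morphism : zmod_morphism beta.
Proof.
move=> y w; rewrite /beta -sumrB.
by apply: eq_bigr => i _; rewrite !mxE mulrzBr.
Qed.
HB.instance Definition _ :=
  GRing.isZmodMorphism.Build _ _ beta beta_is_zmod_morphism.

Lemma beta_std i : beta (stdZ i) = nu i *+ m i.
Proof.
rewrite /beta (bigD1 i) //= !mxE !eqxx big1 ?addr0 // => j /negPf ji.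
by rewrite !mxE eqxx ji.
Qed.

(* The base change of [beta] to R; see [betaR_tens]. *)
Definition betaR : 'Hom('rV[R]_n, 'rV[R]_d) :=
  linfun (mulmxr (\matrix_i tens phi (beta (stdZ i)) 1)).

Lemma betaR_tens y r : betaR (tensZ y r) = tens phi (beta y) r.
Proof.
rewrite lfunE /= /tensZ /tens -scalemxAl; congr (_ *: _).
have -> : phi (beta y) = \sum_i phi (nu i *+ m i) *~ y 0 i.
  by rewrite raddf_sum; apply: eq_bigr => i _; rewrite raddfMz.
apply/rowP => j; rewrite !mxE summxE rmorph_sum /=; apply: eq_bigr => i _.
rewrite !mxE beta_std.
by rewrite mul1r -[phi _ *~ _]scaler_int mxE rmorphM /= intz.
Qed.

(* The map induced on R^n / Z^n by [betaR]; see [betabar_texp]. *)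
Definition betabar (t : torus R n) : torus R d := texp (betaR (trepr t)).

Lemma betabar_texp v : betabar (texp v) = texp (betaR v).
Proof.
apply/eqP; rewrite -subr_eq0 -raddfB -linearB /=; apply/eqP.
set w := trepr _ - v.
have /texp_eq0 wZ : texp w = 0 by rewrite raddfB /= treprK subrr.
apply/texp_eq0 => j; rewrite lfunE /= mxE; apply: rpred_sum => i _.
by rewrite rpredM // !mxE mul1r intr_int.
Qed.

Lemma betabar_is_zmod_morphism : zmod_morphism betabar.
Proof.
move=> s t; rewrite -[s]treprK -[t]treprK -raddfB !betabar_texp.
by rewrite linearB raddfB.
Qed.
HB.instance Definition _ :=
  GRing.isZmodMorphism.Build _ _ betabar betabar_is_zmod_morphism.

Definition inK : {pred torus R n} := fun t => betabar t == 0.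
Lemma inK_zmod_closed : zmod_closed inK.
Proof.
split=> [|s t]; first by rewrite /inK unfold_in raddf0.
by rewrite !unfold_in raddfB /= => /eqP-> /eqP->; rewrite subrr.
Qed.
HB.instance Definition _ := GRing.isZmodClosed.Build _ inK inK_zmod_closed.

Record KD := MkKD { kd_val :> torus R n; _ : kd_val \in inK }.
HB.instance Definition _ := [isSub for kd_val].
HB.instance Definition _ := [Choice of KD by <:].
HB.instance Definition _ := [SubChoice_isSubZmodule of KD by <:].

Definition Stab (z : 'rV[R[i]]_n) : set KD :=
  [set t | torus_act (kd_val t) z = z].

Definition lieK : {vspace 'rV[R]_n} := lker betaR.

(* The dual of the inclusion of [lieK] in R^n, on (R^n)^* identified with R^n
   by the standard basis. *)
Definition iota_dual (w : 'rV[R]_n) : dual (subvs_of lieK) :=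
  linfun (fun v : subvs_of lieK => (vsval v *m w^T) 0 0 : R^o).

Lemma iota_dualE w v : iota_dual w v = \sum_i vsval v 0 i * w 0 i.
Proof.
have lin : linear (fun v : subvs_of lieK => (vsval v *m w^T) 0 0 : R^o).
  by move=> a u u'; rewrite linearP mulmxDl -scalemxAl !mxE.
pose f := HB.pack_for {linear subvs_of lieK -> R^o}
  (fun v : subvs_of lieK => (vsval v *m w^T) 0 0 : R^o)
  (GRing.isLinear.Build _ _ _ _ _ lin).
rewrite /iota_dual -[LHS]/(linfun f v) lfunE /= mxE.
by apply: eq_bigr => i _; rewrite mxE.
Qed.

(* [kappa] is the conventional positive normalization of the moment map. *)
Definition moment (kappa : R) (z : 'rV[R[i]]_n) : dual (subvs_of lieK) :=
  kappa *: iota_dual (\row_i (ComplexField.Normc.normc (z 0 i) ^+ 2)).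

Definition level (c : 'I_n -> R) : dual (subvs_of lieK) :=
  iota_dual (\row_i c i).

Definition zeros (z : 'rV[R[i]]_n) : pred 'I_n := fun i => z 0 i == 0.

Definition Nz (z : 'rV[R[i]]_n) : {pred N} :=
  zspan (zeros z) (fun i => nu i *+ m i).
HB.instance Definition _ z := GRing.ZmodClosed.on (Nz z).

Definition N_mod_Nz (z : 'rV[R[i]]_n) := Quotient.quot (Nz z).
HB.instance Definition _ z := GRing.Zmodule.on (N_mod_Nz z).

Definition coset_Nz (z : 'rV[R[i]]_n) (x : N) : N_mod_Nz z :=
  \pi_(Quotient.quot (Nz z)) x.

End Delzant.

(* Main.v *)
Require Import Defs.
From HB Require Import structures.
From mathcomp Require Import all_boot all_order all_algebra.
From mathcomp Require Import all_classical all_reals all_analysis.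
From mathcomp Require Import ring lra.

(** Let b_i = beta (e_i), and let I be the set of zeros of z. Everything follows
    from one fact of polyhedral geometry: the vectors b_i (x) 1, for i in I, are
    linearly independent over R.

    By [level_point], z lies above a point p of the polytope at which the
    inequality of index i is an equality exactly when i is in I. Moving p along
    directions that keep its active inequalities active ([tighten]) leads to a
    point q where the active b_i span ([tight_spanning_point]), which is therefore
    a vertex ([tight_spanning_vertex]). As the polytope is simple, q lies on d
    facets, so at most d of the b_i are active at q; since they span they form a
    basis, and those with i in I are among them ([labelled_tight_free]).

    Independence makes beta_R injective on the space R^I of vectors supported on
    I. Call w in R^I a lift of x in N when beta_R w = x (x) 1 ([lifts]). Lifts
    are unique and additive, and if k x = beta y with y in Z^I then y (x) 1/k is
    the lift of x; so every x that is torsion modulo N_z has a lift, and the map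
    of the theorem sends the class of x to exp w. It is well defined and injective
    because the lift of x is integral exactly when x is in N_z
    ([lifts_coset], [lifts_integral]).

    For the image: t fixes z exactly when its coordinates outside I are trivial
    ([stab_supp]), so an element of Stab(z) is exp w with w in R^I, and membership
    in K_D means that beta_R w is integral, i.e. w lifts some x in N. That x is
    torsion modulo N_z because a real combination of integer vectors which is
    integral is also a rational one ([real_span_rational], [lifts_torsion]). *)

Import Order.TTheory GRing.Theory Num.Theory.
Local Open Scope classical_set_scope.
Local Open Scope ring_scope.

(** * Vertices of bounded polyhedra *)

Section Polyhedra.
Set Implicit Arguments.
Unset Strict Implicit.
Variables (R : realType) (d : nat).

Definition pairing (u : 'cV[R]_d) : NRdual R d :=
  linfun (fun v : 'rV[R]_d => (v *m u) 0 0 : R^o).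

Lemma pairingE (u : 'cV[R]_d) (v : 'rV[R]_d) : pairing u v = (v *m u) 0 0.
Proof.
have lin : linear (fun v : 'rV[R]_d => (v *m u) 0 0 : R^o).
  by move=> a w w'; rewrite mulmxDl -scalemxAl !mxE.
pose f := HB.pack_for {linear 'rV[R]_d -> R^o}
  (fun v : 'rV[R]_d => (v *m u) 0 0 : R^o)
  (GRing.isLinear.Build _ _ _ _ _ lin).
by rewrite /pairing -[LHS]/(linfun f v) lfunE.
Qed.

Lemma exists_annihilator (k : nat) (A : 'M[R]_(k, d)) : ~~ row_full A ->
  exists2 u : NRdual R d, u != 0 & forall i, u (row i A) = 0.
Proof.
rewrite -cokermx_eq0 => /eqP A_neq0.
have [j uj0] : exists j, col j (cokermx A) != 0.
  apply: contrapT => no; apply: A_neq0; apply/matrixP => i j; rewrite !mxE.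
  have /negP/negPn/eqP/colP/(_ i) : ~ col j (cokermx A) != 0.
    by move=> uj; apply: no; exists j.
  by rewrite !mxE.
exists (pairing (col j (cokermx A))).
  apply: contraNneq uj0 => p0; apply/eqP/colP => i; rewrite [RHS]mxE.
  have := pairingE (col j (cokermx A)) (delta_mx 0 i).
  by rewrite p0 lfunE -rowE /= !mxE.
move=> i; rewrite pairingE colE mulmxA -(row_mul i A (cokermx A)) mulmx_coker.
by rewrite row0 mul0mx mxE.
Qed.

Lemma dual_eq0 (k : nat) (A : 'M[R]_(k, d)) (u : NRdual R d) :
  row_full A -> (forall i, u (row i A) = 0) -> u = 0.
Proof.
move=> A_full uA0; apply/lfunP => v; rewrite lfunE /=.
have /submxP[w ->] : (v <= A)%MS by rewrite submx_full.
rewrite mulmx_sum_row linear_sum big1 // => i _.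
by rewrite linearZ /= uA0 scaler0.
Qed.

(** A linear form is bounded on a convex hull of finitely many points, but it is
    unbounded on a ray along whose direction it is positive. *)
Lemma polytope_no_ray (D : set (NRdual R d)) (p u : NRdual R d) :
  polytope D -> (forall t, 0 <= t -> D (p + t *: u)) -> u = 0.
Proof.
case=> s ->{D} ray.
wlog suff nonpos : u ray / forall v, u v <= 0.
  apply/lfunP => v; rewrite lfunE /=; apply/eqP; rewrite eq_le nonpos //.
  by have := nonpos u ray (- v); rewrite raddfN oppr_le0.
move=> v; rewrite leNgt; apply/negP => uv_gt0.
pose M := \sum_(j < size s) `|(s`_j : NRdual R d) v|.
have M_ge0 : 0 <= M by apply: sumr_ge0.
have bound t : 0 <= t -> (p v : R) + t * (u v : R) <= M.
  move=> /ray[a [a0 a1 e]].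
  have -> : (p v : R) + t * (u v : R) = (p + t *: u) v by rewrite !lfunE /= lfunE.
  rewrite e sum_lfunE; apply: ler_sum => j _; rewrite lfunE /=.
  apply: le_trans (ler_norm _) _; rewrite normrM ger0_norm //.
  rewrite ler_piMl // -a1 (bigD1 j) //= lerDl.
  by apply: sumr_ge0.
move: (u v : R) (p v : R) uv_gt0 bound => s1 s0 s1_gt0 bound.
have t_ge0 : 0 <= (M + 1 + `|s0|) / s1.
  by apply: divr_ge0; [rewrite !addr_ge0 | exact: ltW].
have := bound _ t_ge0; rewrite divfK ?gt_eqF //.
by have := ler_norm (- s0); rewrite normrN; lra.
Qed.

Variables (n : nat) (b : 'I_n -> 'rV[R]_d) (c : 'I_n -> R).

Definition polyhedron : set (NRdual R d) := [set p | forall i, - c i <= p (b i)].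

Definition tight (p : NRdual R d) : pred 'I_n := fun i => p (b i) == - c i.

Definition tight_mx (p : NRdual R d) : 'M[R]_(#|tight p|, d) :=
  \matrix_k b (enum_val k).

Lemma tight_mx_row (p : NRdual R d) (u : NRdual R d) :
  (forall k, u (row k (tight_mx p)) = 0) <->
  (forall i, tight p i -> u (b i) = 0).
Proof.
split=> [u0 i pi | u0 k]; last by rewrite rowK; exact/u0/(enum_valP k).
by have := u0 (enum_rank_in pi i); rewrite rowK enum_rankK_in.
Qed.

(** If the active vectors at [p] do not span, some direction [u] kills them all.
    Boundedness forces the ray from [p] along [u] to leave the polyhedron; at
    the exit point the active inequalities at [p] are still equalities, and at
    least one more has become one. *)
Lemma tighten (p : NRdual R d) :
  polytope polyhedron -> polyhedron p -> ~~ row_full (tight_mx p) ->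
  exists q, [/\ polyhedron q, subpred (tight p) (tight q) &
    (#|tight p| < #|tight q|)%N].
Proof.
move=> Dpoly Dp /exists_annihilator[u u_neq0 /tight_mx_row u_tight].
have [i0 ui0] : exists i, (u (b i) : R) < 0.
  apply: contrapT => no; move/eqP: u_neq0; apply.
  apply: (polytope_no_ray (p := p) Dpoly) => t t0 i.
  rewrite !lfunE /= lfunE; apply: le_trans (Dp i) _; rewrite lerDl.
  apply: mulr_ge0 => //; rewrite leNgt; apply/negP => ui; apply: no.
  by exists i.
(* [time i] is when the ray meets the hyperplane of the [i]-th inequality. *)
pose time i : R := (p (b i) + c i) / - u (b i).
have [i ui_lt0 time_min] := @arg_minP _ _ _ i0 (fun i => (u (b i) : R) < 0) time ui0.
have slack j : 0 <= (p (b j) : R) + c j by rewrite -lerBlDr sub0r; exact: Dp.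
have time_ge0 : 0 <= time i.
  by apply: divr_ge0; [exact: slack | rewrite oppr_ge0 ltW].
have qE j : (p + time i *: u) (b j) = (p (b j) : R) + time i * (u (b j) : R).
  by rewrite !lfunE /= lfunE.
have q_tight : subpred (tight p) (tight (p + time i *: u)).
  by move=> j pj; rewrite /tight qE u_tight // mulr0 addr0.
have i_tight : tight (p + time i *: u) i.
  rewrite /tight qE /time; move: (u (b i) : R) (p (b i) : R) ui_lt0 => r s r_lt0.
  by apply/eqP; field; rewrite lt_eqF.
exists (p + time i *: u); split=> // [j|].
  rewrite qE; have [uj|uj] := leP 0 (u (b j) : R).
    by apply: le_trans (Dp j) _; rewrite lerDl mulr_ge0.
  have := time_min j uj; rewrite {2}/time ler_pdivlMr ?oppr_gt0 //.
  by rewrite mulrN lerNl -subr_ge0; lra.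
apply: proper_card; apply/properP; split.
  by apply/fintype.subsetP => j; exact: q_tight.
exists i => //; apply/negP => /u_tight ui0'.
by rewrite ui0' ltxx in ui_lt0.
Qed.

Lemma tight_spanning_point (p : NRdual R d) :
  polytope polyhedron -> polyhedron p ->
  exists q, [/\ polyhedron q, subpred (tight p) (tight q) &
    row_full (tight_mx q)].
Proof.
move=> Dpoly; move: {2}(n - #|tight p|)%N (erefl (n - #|tight p|)%N) => k.
elim/ltn_ind: k p => k IH p kE Dp.
case: (boolP (row_full (tight_mx p))) => [p_full|]; first by exists p; split.
case/(tighten Dpoly Dp) => q [Dq pq pq_card].
have [] := IH (n - #|tight q|)%N _ q erefl Dq.
  rewrite -kE ltn_sub2l // (leq_trans pq_card) //.
  by rewrite -[X in (_ <= X)%N]card_ord max_card.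
move=> r [Dr qr r_full]; exists r; split=> // i /pq; exact: qr.
Qed.

(** The sum of the active vectors, as a linear form on the dual space, is
    minimal exactly where all these inequalities are equalities, and spanning
    leaves a single such point. *)
Lemma tight_spanning_vertex (q : NRdual R d) :
  polyhedron q -> row_full (tight_mx q) -> is_vertex polyhedron q.
Proof.
move=> Dq q_full.
pose w := \sum_(i | tight q i) b i.
pose ev := linfun (fun p : NRdual R d => (p w : R^o)).
have evE p : ev p = \sum_(i | tight q i) (p (b i) : R).
  have lin : linear (fun p : NRdual R d => (p w : R^o)).
    by move=> a u v; rewrite !lfunE /= lfunE.
  pose f := HB.pack_for {linear NRdual R d -> R^o}
    (fun p : NRdual R d => (p w : R^o)) (GRing.isLinear.Build _ _ _ _ _ lin).
  by rewrite /ev -[LHS]/(linfun f p) lfunE /= linear_sum.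
have ev_min p : polyhedron p -> ev q <= ev p.
  move=> Dp; rewrite !evE; apply: ler_sum => i /eqP ->; exact: Dp.
exists ev; apply/seteqP; split=> [p -> //|p [Dp p_min]].
have ev_eq : ev p = ev q by apply/eqP; rewrite eq_le ev_min // p_min.
apply/eqP; rewrite -subr_eq0; apply/eqP.
apply: (dual_eq0 q_full); apply/tight_mx_row => i qi.
rewrite !lfunE /= lfunE /=; apply/eqP; rewrite subr_eq0; apply/eqP.
have le_qp j : tight q j -> (q (b j) : R) <= p (b j) by move/eqP ->; exact: Dp.
move: ev_eq; rewrite !evE => /esym/eqP.
rewrite (leif_sum (fun j qj => leif_eq (le_qp j qj))).
by move=> /forall_inP/(_ i qi)/eqP.
Qed.

(** At most [d] vectors that span a space of dimension [d] form a basis. *)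
Lemma few_tight_free (q : NRdual R d) (w : 'rV[R]_n) :
  (#|tight q| <= d)%N -> row_full (tight_mx q) ->
  (forall i, ~~ tight q i -> w 0 i = 0) -> \sum_i w 0 i *: b i = 0 -> w = 0.
Proof.
move=> q_few q_full w_supp wb0.
have q_free : row_free (tight_mx q).
  rewrite /row_free eqn_leq rank_leq_row.
  by move/eqP: q_full => ->.
pose w' : 'rV[R]_(#|tight q|) := \row_k w 0 (enum_val k).
have /(row_free_inj q_free) w'0 : w' *m tight_mx q = 0 *m tight_mx q.
  have tight_sum : \sum_(i in tight q) w 0 i *: b i = 0.
    rewrite -[RHS]wb0 [RHS](bigID (tight q)) /=.
    by rewrite [X in _ + X]big1 ?addr0 // => i /w_supp ->; rewrite scale0r.
  rewrite mul0mx mulmx_sum_row -[RHS]tight_sum (big_enum_val (A := tight q)).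
  by apply: eq_bigr => k _; rewrite rowK mxE.
apply/rowP => i; rewrite mxE; case: (boolP (tight q i)) => [qi|/w_supp //].
by have /rowP/(_ (enum_rank_in qi i)) := w'0; rewrite !mxE enum_rankK_in.
Qed.

End Polyhedra.

(** * Real and rational spans of integer vectors *)

Section RationalSpan.
Set Implicit Arguments.
Unset Strict Implicit.

Lemma clear_denominators (n : nat) (r : 'rV[rat]_n) :
  exists2 k : nat, (0 < k)%N &
    exists a : 'rV[int]_n, map_mx intr a = k%:R *: r.
Proof.
exists (\prod_i `|denq (r 0%R i)|)%N.
  by rewrite prodn_gt0 // => i; rewrite absz_gt0 denq_neq0.
exists (\row_i ((\prod_(j | j != i) `|denq (r 0%R j)|)%N%:Z * numq (r 0 i))).
apply/rowP => i; rewrite !mxE [in RHS](bigD1 i) //= natrM rmorphM /=.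
rewrite -pmulrn natr_absz ger0_norm // -[X in _ = _ * X]divq_num_den.
have : (denq (r 0%R i))%:~R != 0 :> rat by rewrite intr_eq0 denq_neq0.
by move=> den_neq0; field.
Qed.

(** The rank of a rational matrix does not change under extension of scalars, so
    an integer vector that is a real combination of integer vectors is a rational
    one; this is what makes elements of the stabilizer have finite order. *)
Lemma real_span_rational (R : realType) (n d : nat) (P : pred 'I_n)
    (u : 'I_n -> 'rV[int]_d) (x : 'rV[int]_d) (w : 'rV[R]_n) :
  (forall i, ~~ P i -> w 0 i = 0) ->
  \sum_i w 0 i *: map_mx intr (u i) = map_mx intr x ->
  exists2 k : nat, (0 < k)%N &
    exists a : 'I_n -> int, x *+ k = \sum_(i | P i) u i *~ a i.
Proof.
move=> w_supp wx.
pose A : 'M[int]_(n, d) := \matrix_i (if P i then u i else 0).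
have ratrE k (B : 'M[int]_(k, d)) :
    map_mx intr B = map_mx ratr (map_mx intr B : 'M[rat]_(k, d)) :> 'M[R]_(k, d).
  by apply/matrixP => i j; rewrite !mxE ratr_int.
have : (map_mx intr x <= (map_mx intr A : 'M[R]_(n, d)))%MS.
  apply/submxP; exists w; rewrite -wx mulmx_sum_row; apply: eq_bigr => i _.
  rewrite -map_row rowK; case: ifPn => [//|/w_supp ->]; by rewrite !scale0r.
rewrite !ratrE map_submx => /submxP[r xr].
have [k k_gt0 [a ar]] := clear_denominators r.
exists k => //; exists (fun i => a 0 i).
have intr_mx_inj : injective (fun y : 'rV[int]_d => map_mx intr y : 'rV[rat]_d).
  move=> y y' /rowP yy'; apply/rowP => j; apply: (@intr_inj rat).
  by have := yy' j; rewrite !mxE.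
apply: intr_mx_inj => /=.
rewrite raddfMn /= xr -scaler_nat scalemxAl -ar -map_mxM /=; congr (map_mx _ _).
rewrite mulmx_sum_row (bigID P) /= [X in _ + X]big1 ?addr0; last first.
  by move=> i /negPf Pi; rewrite rowK Pi scaler0.
by apply: eq_bigr => i Pi; rewrite rowK Pi -scaler_int intz.
Qed.

End RationalSpan.

(** * The circle R/Z *)

Section Circle.
Set Implicit Arguments.
Unset Strict Implicit.
Variable R : realType.

Lemma cos_full_turns (t : R) (k : int) :
  cos (2 * pi * (t + k%:~R)) = cos (2 * pi * t).
Proof.
have nat_turns (s : R) (j : nat) : cos (2 * pi * (s + j%:R)) = cos (2 * pi * s).
  rewrite -[RHS](periodicn (@cosD2pi R) j); congr cos.
  by rewrite -[_ *+ j]mulr_natr; ring.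
case: k => j; first exact: nat_turns.
by rewrite NegzE mulrNz -[LHS](nat_turns _ j.+1) addrNK.
Qed.

Lemma cos_turn_eq1 (t : R) : cos (2 * pi * t) = 1 <-> t \in Num.int.
Proof.
split=> [|/intrP[k ->]]; last first.
  by rewrite -[k%:~R]add0r cos_full_turns mulr0 cos0.
pose s := t - (Num.floor t)%:~R; have tE : t = s + (Num.floor t)%:~R by rewrite subrK.
have s_ge0 : 0 <= s by rewrite subr_ge0 floor_le.
have s_lt1 : s < 1 by rewrite ltrBlDr -(intrD _ 1) addrC floorD1_gt.
rewrite {1}tE cos_full_turns => cos1.
suff s0 : s = 0 by rewrite tE s0 add0r intr_int.
apply/eqP; apply: contraT => s_neq0; exfalso.
have : 0 < sin (pi * s).
  have s_gt0 : 0 < s by rewrite lt_neqAle eq_sym s_neq0.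
  by have pi0 := pi_gt0 R; apply: sin_gt0_pi; apply/andP; split; nra.
have := cos2Dsin2 (pi * s); have := cosD (pi * s) (pi * s).
have -> : pi * s + pi * s = 2 * pi * s by ring.
by rewrite cos1; nra.
Qed.

(** The character t |-> e^(2 pi i t) is faithful on R/Z: after reduction of [t]
    to [0, 1), a full cosine forces sin (pi t) = 0, hence t = 0. *)
Lemma circle_val_eq1 (s : circle R) : circle_val s = 1 <-> s = 0.
Proof.
set t : R := repr (s : Quotient.quot (@Zsub R)).
have s0 : s = 0 <-> t \in Num.int.
  have -> : (t \in Num.int) = (t == 0 %[mod Quotient.quot (@Zsub R)])%qT.
    by rewrite -Quotient.idealrBE subr0.
  rewrite reprK (raddf0 \pi_(Quotient.quot (@Zsub R))%qT).
  by split => /eqP.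
rewrite s0 -cos_turn_eq1 /circle_val -/t; split=> [[]//|cos1].
rewrite cos1; congr (_ +i* _)%C.
by have := cos2Dsin2 (2 * pi * t); rewrite cos1; nra.
Qed.

End Circle.

(** * The normals active at a point of the level set *)

Section LabelledPolytopes.
Set Implicit Arguments.
Unset Strict Implicit.
Variables (R : realType) (d n : nat) (N : zmodType).
Variables (phi : {additive N -> 'rV[int]_d}) (nu : 'I_n -> N).

(** The level equation says that the vector (kappa |z_i|^2 - c_i)_i is
    orthogonal to the kernel of [betaR]; the orthogonal of a kernel is the image
    of the transpose, which provides [p]. *)
Lemma level_point (m : 'I_n -> nat) (kappa : R) (c : 'I_n -> R) (z : 'rV[R[i]%C]_n) :
  moment phi nu m kappa z = level phi nu m c ->
  exists p : NRdual R d, forall i,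
    p (tens phi (beta nu m (stdZ i)) 1) =
    kappa * ComplexField.Normc.normc (z 0 i) ^+ 2 - c i.
Proof.
move=> mz.
pose B : 'M[R]_(n, d) := \matrix_i tens phi (beta nu m (stdZ i)) 1.
pose s : 'rV[R]_n := \row_i (kappa * ComplexField.Normc.normc (z 0 i) ^+ 2 - c i).
have s_ker (v : 'rV[R]_n) : v *m B = 0 -> \sum_i v 0 i * s 0 i = 0.
  move=> vB.
  have v_lieK : v \in lieK R phi nu m by rewrite memv_ker lfunE /= vB.
  have := congr1 (fun f : dual (subvs_of (lieK R phi nu m)) =>
    f (Subvs v_lieK)) mz.
  rewrite /moment /level lfunE /= !iota_dualE /= => e.
  have -> : \sum_i v 0 i * s 0 i =
      kappa * (\sum_i v 0 i * (\row_j ComplexField.Normc.normc (z 0 j) ^+ 2) 0 i)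
      - \sum_i v 0 i * (\row_j c j) 0 i.
    by rewrite mulr_sumr -sumrB; apply: eq_bigr => i _; rewrite !mxE; ring.
  by apply/eqP; rewrite subr_eq0; apply/eqP; exact: e.
have : (s <= B^T)%MS.
  rewrite submxE; apply/eqP/rowP => j; rewrite [RHS]mxE mxE.
  rewrite -[RHS](s_ker (col j (cokermx B^T))^T).
    by apply: eq_bigr => i _; rewrite !mxE mulrC.
  apply: trmx_inj; rewrite trmx_mul trmxK trmx0 colE mulmxA mulmx_coker.
  by rewrite mul0mx.
case/submxP => y sE; exists (pairing y^T) => i.
rewrite pairingE.
have -> : tens phi (beta nu m (stdZ i)) 1 = row i B by rewrite rowK.
have := congr1 (fun v : 'rV[R]_n => v 0 i) sE; rewrite /s !mxE => ->.
by apply: eq_bigr => j _; rewrite !mxE mulrC.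
Qed.

(** Equality in the [i]-th inequality makes evaluation at the [i]-th normal
    minimal at [q], and the facet is where this minimum is attained. *)
Lemma labelled_tight_facet (Delta : labelled_polytope R phi n) (c : 'I_n -> R)
    (q : NRdual R d) (i : 'I_n) :
  let b i := tens phi (beta nu (lp_label Delta) (stdZ i)) 1 in
  primitive_normals Delta nu -> lp_set Delta = polyhedron b c ->
  polyhedron b c q -> tight b c q i -> lp_facet Delta i q.
Proof.
move=> b nu_normal DE Dq /eqP qi.
have [_ ->] := nu_normal i; split; first by rewrite DE.
move=> p; rewrite DE => /(_ i); rewrite -qi /b beta_std.
have -> : tens phi (nu i *+ lp_label Delta i) 1 =
    (lp_label Delta i)%:R *: tens phi (nu i) 1 :> 'rV[R]_d.
  by rewrite /tens raddfMn /= raddfMn /= !scale1r scaler_nat.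
by rewrite !linearZ /= ler_pM2l // ltr0n lp_label_gt0.
Qed.

Lemma labelled_vertex_card (Delta : labelled_polytope R phi n) (q : NRdual R d) :
  is_vertex Delta q ->
  forall P : pred 'I_n, (forall i, P i -> lp_facet Delta i q) -> (#|P| <= d)%N.
Proof.
move=> q_vertex P P_facet.
have [_ /(_ d (lp_full_dim Delta) q q_vertex)] := lp_simple Delta.
move=> /card_eqPle[facets_le _]; rewrite -card_le_II.
apply: card_le_trans facets_le.
apply: card_le_trans (subset_card_le (A := (fun k => lp_facet Delta (enum_val k)) @` [set: 'I_#|P|]) _).
  have inj : {in [set: 'I_#|P|] &, injective (fun k => lp_facet Delta (enum_val k))}.
    by move=> k l _ _ /(lp_facet_inj (l:=Delta)) /enum_val_inj.
  have /card_eqPle[_ le1] := inj_card_eq inj.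
  by have /card_eqPle[le2 _] := @card_II #|P|; exact: card_le_trans le2 le1.
by move=> _ [k _ <-]; split; [apply/lp_facetP; exists (enum_val k) | exact/P_facet/enum_valP].
Qed.

(** Simplicity only speaks of vertices, so [p] is first replaced by a vertex at
    which all the inequalities active at [p] are still active: there at most [d]
    inequalities are active and their vectors span, so they are independent. *)
Lemma labelled_tight_free (Delta : labelled_polytope R phi n) (c : 'I_n -> R)
    (p : NRdual R d) (w : 'rV[R]_n) :
  let b i := tens phi (beta nu (lp_label Delta) (stdZ i)) 1 in
  primitive_normals Delta nu -> lp_set Delta = polyhedron b c ->
  polyhedron b c p -> (forall i, ~~ tight b c p i -> w 0 i = 0) ->
  betaR R phi nu (lp_label Delta) w = 0 -> w = 0.
Proof.
move=> b nu_normal DE Dp w_supp w0.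
have Dpoly : polytope (polyhedron b c) by rewrite -DE; case: (lp_simple Delta).
have [q [Dq pq q_full]] := tight_spanning_point Dpoly Dp.
have q_vertex : is_vertex Delta q by rewrite DE; exact: tight_spanning_vertex.
apply: (few_tight_free (labelled_vertex_card q_vertex _) q_full).
- by move=> i; exact: labelled_tight_facet.
- by move=> i qi; apply: w_supp; apply: contraNN qi; exact: pq.
rewrite -[RHS]w0 lfunE /= mulmx_sum_row; apply: eq_bigr => i _.
by rewrite rowK.
Qed.
End LabelledPolytopes.

(** * Stabilizers as torsion groups *)

Section Stabilizer.
Set Implicit Arguments.
Unset Strict Implicit.
Variables (R : realType) (d n : nat) (N : zmodType).
Variables (phi : {additive N -> 'rV[int]_d}) (nu : 'I_n -> N) (m : 'I_n -> nat).
Variable z : 'rV[R[i]%C]_n.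

Lemma coset_Nz_eq (x y : N) :
  coset_Nz nu m z x = coset_Nz nu m z y <-> x - y \in Nz nu m z.
Proof. by rewrite Quotient.idealrBE; split=> /eqP. Qed.

Lemma coset_Nz_torsion (x : N) :
  coset_Nz nu m z x \in torsion (N_mod_Nz nu m z) <->
  exists2 k : nat, (0 < k)%N & x *+ k \in Nz nu m z.
Proof.
have cosetMn k : coset_Nz nu m z x *+ k = 0 <-> x *+ k \in Nz nu m z.
  rewrite -[x *+ k]subr0 -coset_Nz_eq /coset_Nz raddfMn.
  by rewrite (raddf0 \pi_(Quotient.quot (Nz nu m z))%qT).
by split=> [/asboolP[k k0 /cosetMn] | [k k0 /cosetMn xk]];
  [exists k | apply/asboolP; exists k].
Qed.

Lemma zspan_stdP (y : 'rV[int]_n) :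
  y \in zspan (zeros z) (@stdZ n) <-> forall i, z 0 i != 0 -> y 0 i = 0.
Proof.
split=> [/asboolP[a ->] i zi | y_supp].
  rewrite summxE big1 // => j /eqP zj.
  rewrite -scaler_int !mxE; case: (eqVneq i j) => [ij|_]; last by rewrite mulr0.
  by rewrite ij zj eqxx in zi.
apply/asboolP; exists (y 0); rewrite [LHS]row_sum_delta (bigID (zeros z)) /=.
rewrite [X in _ + X]big1 ?addr0; last by move=> i /y_supp ->; rewrite scale0r.
by apply: eq_bigr => i _; rewrite -scaler_int intz.
Qed.

Lemma Nz_betaP (x : N) : x \in Nz nu m z <->
  exists2 y, y \in zspan (zeros z) (@stdZ n) & beta nu m y = x.
Proof.
have betaE (a : 'I_n -> int) :
    beta nu m (\sum_(i | zeros z i) stdZ i *~ a i) =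
    \sum_(i | zeros z i) (nu i *+ m i) *~ a i.
  by rewrite raddf_sum; apply: eq_bigr => i _; rewrite raddfMz /= beta_std.
split=> [/asboolP[a ->] | [y /asboolP[a ->] <-]].
  by exists (\sum_(i | zeros z i) stdZ i *~ a i); [apply/asboolP; exists a|].
by apply/asboolP; exists a; rewrite betaE.
Qed.

(** Real lifts of [x] along [betaR] whose support lies in the zeros of [z]. They
    extend the fractions (y, k) with beta y = k x, whose lift is y (x) 1/k, and,
    unlike a choice of [y] and [k], they are additive in [x]. *)
Definition lifts (x : N) (w : 'rV[R]_n) : Prop :=
  (forall i, z 0 i != 0 -> w 0 i = 0) /\ betaR R phi nu m w = tens phi x 1.

Lemma liftsB (x x' : N) (w w' : 'rV[R]_n) :
  lifts x w -> lifts x' w' -> lifts (x - x') (w - w').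
Proof.
move=> [w0 wE] [w'0 w'E]; split=> [i zi|]; first by rewrite !mxE w0 ?w'0 ?subrr.
by rewrite linearB /= wE w'E /tens !scale1r raddfB map_mxB.
Qed.

Lemma lifts_fraction (x : N) (y : 'rV[int]_n) (k : nat) :
  (0 < k)%N -> y \in zspan (zeros z) (@stdZ n) -> beta nu m y = x *+ k ->
  lifts x (tensZ y k%:R^-1).
Proof.
move=> k_gt0 /zspan_stdP y_supp yx; split=> [i zi|].
  by rewrite !mxE y_supp // mulr0.
rewrite betaR_tens yx /tens raddfMn /= raddfMn /= -[X in _ *: X]scaler_nat scalerA mulVf //.
by rewrite pnatr_eq0 -lt0n.
Qed.

Lemma lifts_inK (x : N) (w : 'rV[R]_n) :
  lifts x w -> texp w \in inK phi nu m.
Proof.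
case=> _ wE; rewrite unfold_in betabar_texp wE; apply/eqP/texp_eq0 => i.
by rewrite !mxE mul1r intr_int.
Qed.

(** The vectors [phi (beta (stdZ i))] are integral, so a real lift is enough for
    a multiple of [x] to be an integral combination of them. *)
Lemma lifts_torsion (x : N) (w : 'rV[R]_n) : injective phi ->
  lifts x w -> coset_Nz nu m z x \in torsion (N_mod_Nz nu m z).
Proof.
move=> phi_inj [w0 wE]; apply/coset_Nz_torsion.
have [|k k_gt0 [a ax]] := @real_span_rational R n d (zeros z)
    (fun i => phi (nu i *+ m i)) (phi x) w w0.
  transitivity (betaR R phi nu m w); last by rewrite wE /tens scale1r.
  rewrite lfunE /= mulmx_sum_row.
  by apply: eq_bigr => i _; rewrite rowK beta_std /tens scale1r.
exists k => //; apply/asboolP; exists a; apply: phi_inj.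
rewrite raddfMn /= ax raddf_sum; apply: eq_bigr => i _.
by rewrite raddfMz.
Qed.

Lemma lifts_integral (x : N) (w : 'rV[R]_n) : injective phi ->
  lifts x w -> texp w = 0 -> x \in Nz nu m z.
Proof.
move=> phi_inj [w0 wE] /texp_eq0 w_int.
pose y : 'rV[int]_n := \row_i Num.floor (w 0 i).
have yw : tensZ y (1 : R) = w.
  by apply/rowP => i; rewrite !mxE mul1r; apply/eqP; rewrite -intrEfloor.
apply/Nz_betaP; exists y.
  by apply/zspan_stdP => i /w0; rewrite mxE => ->; rewrite floor0.
apply: phi_inj; apply/rowP => j; apply: (@intr_inj R).
have := wE; rewrite -yw betaR_tens /tens !scale1r => /rowP/(_ j).
by rewrite !mxE.
Qed.

Lemma stab_supp (t : torus R n) :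
  torus_act t z = z <-> forall i, z 0 i != 0 -> t 0 i = 0.
Proof.
split=> [/rowP tz i zi|t0]; last apply/rowP => i.
  apply/circle_val_eq1; apply: (mulIf zi); rewrite mul1r.
  by have := tz i; rewrite mxE.
rewrite mxE; have [->|zi] := eqVneq (z 0 i) 0; first by rewrite mulr0.
by rewrite t0 // (proj2 (circle_val_eq1 0)) // mul1r.
Qed.

Hypothesis phi_bij : bijective phi.
Hypothesis zeros_free : forall w : 'rV[R]_n,
  (forall i, z 0 i != 0 -> w 0 i = 0) -> betaR R phi nu m w = 0 -> w = 0.

Lemma lifts_uniq (x : N) (w w' : 'rV[R]_n) : lifts x w -> lifts x w' -> w = w'.
Proof.
move=> xw xw'; have [ww0] := liftsB xw xw'; rewrite subrr /tens raddf0 map_mx0 scaler0 => ww.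
by apply/eqP; rewrite -subr_eq0; apply/eqP; exact: zeros_free.
Qed.

(** Representatives of one coset differ by an integral combination, whose lift
    is an integral vector and vanishes in the torus. *)
Lemma lifts_coset (x x' : N) (w w' : 'rV[R]_n) :
  coset_Nz nu m z x = coset_Nz nu m z x' -> lifts x w -> lifts x' w' ->
  texp w = texp w'.
Proof.
move=> /coset_Nz_eq/Nz_betaP[y y_supp yx] xw x'w'.
have wE := lifts_uniq (liftsB xw x'w') (lifts_fraction (k := 1) isT y_supp yx).
apply/eqP; rewrite -subr_eq0 -raddfB wE; apply/eqP/texp_eq0 => i.
by rewrite !mxE invr1 mul1r intr_int.
Qed.

(** The graph of the map to be built; it refers to arbitrary representatives and
    lifts, so that additivity needs no compatible choices. *)
Definition image_of (q : Tor (N_mod_Nz nu m z)) (t : KD R phi nu m) : Prop :=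
  exists x w, [/\ tor_val q = coset_Nz nu m z x, lifts x w & kd_val t = texp w].

Lemma image_of_total (q : Tor (N_mod_Nz nu m z)) : exists t, image_of q t.
Proof.
pose x : N := repr (tor_val q : Quotient.quot (Nz nu m z)).
have qx : tor_val q = coset_Nz nu m z x by rewrite /coset_Nz reprK.
have : coset_Nz nu m z x \in torsion _ by rewrite -qx; exact: valP q.
case/coset_Nz_torsion => k k_gt0 /Nz_betaP[y y_supp yx].
have xw := lifts_fraction k_gt0 y_supp yx.
by exists (MkKD (lifts_inK xw)), x, (tensZ y k%:R^-1).
Qed.

Lemma image_of_fun (q : Tor (N_mod_Nz nu m z)) (t t' : KD R phi nu m) :
  image_of q t -> image_of q t' -> t = t'.
Proof.
move=> [x [w [qx xw tw]]] [x' [w' [qx' xw' tw']]]; apply/val_inj.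
rewrite [LHS]tw [RHS]tw'; apply: (lifts_coset _ xw xw').
by rewrite -qx -qx'.
Qed.

Lemma image_ofB (q q' : Tor (N_mod_Nz nu m z)) (t t' : KD R phi nu m) :
  image_of q t -> image_of q' t' -> image_of (q - q') (t - t').
Proof.
move=> [x [w [qx xw tw]]] [x' [w' [qx' xw' tw']]].
exists (x - x'), (w - w'); split; last 1 first.
- by rewrite -[LHS]/(kd_val t - kd_val t') tw tw' raddfB.
- by rewrite -[LHS]/(tor_val q - tor_val q') qx qx' /coset_Nz raddfB.
- exact: liftsB.
Qed.

(** An element of the stabilizer vanishes off the zeros of [z], hence has a real
    representative [w] supported there; being in K_D makes [betaR w] integral,
    that is, the image of some [x], and then [w] is a lift of [x]. *)
Lemma torsion_stabilizer_iso :
  exists Phi : {additive Tor (N_mod_Nz nu m z) -> KD R phi nu m},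
    [/\ forall (q : Tor (N_mod_Nz nu m z)) (x : N) (w : 'rV[R]_n),
          tor_val q = coset_Nz nu m z x -> lifts x w -> kd_val (Phi q) = texp w,
        injective Phi &
        range Phi = Stab z].
Proof.
have [f fP] := choice image_of_total.
have f_morph : zmod_morphism f.
  by move=> q q'; exact/image_of_fun/image_ofB.
pose Phi := HB.pack_for {additive Tor (N_mod_Nz nu m z) -> KD R phi nu m} f
  (GRing.isZmodMorphism.Build _ _ f f_morph).
have phi_inj := bij_inj phi_bij.
exists Phi; split=> [q x w qx xw||].
- have t_in := lifts_inK xw.
  by have -> : Phi q = MkKD t_in by apply: (image_of_fun (fP q)); exists x, w.
- apply: raddf_inj => q /(congr1 (@kd_val _ _ _ _ _ _ _)) fq0.
  have [x [w [qx xw tw]]] := fP q; apply: val_inj; rewrite [LHS]qx.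
  rewrite [RHS](_ : _ = coset_Nz nu m z 0); last first.
    by symmetry; rewrite /coset_Nz; apply: raddf0.
  apply/coset_Nz_eq; rewrite subr0.
  by apply: (lifts_integral phi_inj xw); rewrite -tw fq0.
apply/seteqP; split=> [_ [q _ <-] | t /stab_supp t_supp].
  have [x [w [_ [w0 _] tw]]] := fP q; apply/stab_supp => i zi.
  rewrite [kd_val _]tw mxE w0 //.
  by apply: raddf0.
(* The representative given by [trepr] is only known to be integral off the zeros
   of [z], so it is replaced by 0 there. *)
pose w : 'rV[R]_n := \row_i if z 0 i == 0 then trepr (kd_val t) 0 i else 0.
have tw : kd_val t = texp w.
  apply/rowP => i; rewrite -[kd_val t in LHS]treprK !mxE.
  case: eqP => [_|/eqP zi]; first by [].
  rewrite reprK t_supp //; symmetry; exact: raddf0.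
have w_supp i : z 0 i != 0 -> w 0 i = 0 by rewrite mxE => /negPf ->.
have : betabar phi nu m (kd_val t) = 0 by apply/eqP; exact: valP t.
rewrite tw betabar_texp => /texp_eq0 bw_int.
case: phi_bij => phi' _ phi'K.
pose x := phi' (\row_j Num.floor (betaR R phi nu m w 0 j)).
have xw : lifts x w.
  split=> //; apply/rowP => j; rewrite /tens phi'K !mxE mul1r.
  by apply/eqP; rewrite eq_sym -intrEfloor.
pose q := MkTor (lifts_torsion phi_inj xw).
exists q => //; apply: (image_of_fun (fP q)).
by exists x, w.
Qed.

Lemma least_multiple_uniq_lift (x : N) :
  coset_Nz nu m z x \in torsion (N_mod_Nz nu m z) ->
  exists2 k : nat, least_multiple (Nz nu m z) x k &
    exists! y : 'rV[int]_n,
      y \in zspan (zeros z) (@stdZ n) /\ beta nu m y = x *+ k.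
Proof.
case/coset_Nz_torsion => k0 k0_gt0 xk0.
have [k /andP[k_gt0 xk] k_min] := ex_minnP (ex_intro
  (fun k => (0 < k)%N && (x *+ k \in Nz nu m z)) k0 (introT andP (conj k0_gt0 xk0))).
exists k; first by split=> // l l_gt0 xl; apply: k_min; rewrite l_gt0.
have /Nz_betaP[y y_supp yx] := xk.
exists y; split=> // y' [y'_supp y'x].
have /rowP yy' := lifts_uniq (lifts_fraction (k := 1) isT y_supp yx)
  (lifts_fraction (k := 1) isT y'_supp y'x).
apply/rowP => i; apply: (@intr_inj R).
by have := yy' i; rewrite !mxE invr1 !mul1r.
Qed.

End Stabilizer.

Theorem proposition2p15 (R : realType) (d n : nat) (N : zmodType)
    (phi : {additive N -> 'rV[int]_d}) (phi_bij : bijective phi)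
    (Delta : labelled_polytope R phi n) (nu : 'I_n -> N)
    (nu_normal : primitive_normals Delta nu)
    (c : 'I_n -> R)
    (Delta_c : lp_set Delta =
       [set x : NRdual R d |
          forall i, - c i <= x (tens phi (beta nu (lp_label Delta) (stdZ i)) 1)])
    (kappa : R) (kappa_gt0 : 0 < kappa)
    (z : 'rV[R[i]%C]_n)
    (z_level : moment phi nu (lp_label Delta) kappa z =
               level phi nu (lp_label Delta) c) :
  (forall x : N,
     coset_Nz nu (lp_label Delta) z x \in torsion (N_mod_Nz nu (lp_label Delta) z) ->
     exists2 k : nat, least_multiple (Nz nu (lp_label Delta) z) x k &
       exists! y : 'rV[int]_n,
         y \in zspan (zeros z) (@stdZ n) /\ beta nu (lp_label Delta) y = x *+ k)
  /\
  exists Phi : {additive Tor (N_mod_Nz nu (lp_label Delta) z) ->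
                         KD R phi nu (lp_label Delta)},
    [/\ forall (q : Tor (N_mod_Nz nu (lp_label Delta) z)) (x : N) (k : nat)
               (y : 'rV[int]_n),
          tor_val q = coset_Nz nu (lp_label Delta) z x ->
          least_multiple (Nz nu (lp_label Delta) z) x k ->
          y \in zspan (zeros z) (@stdZ n) ->
          beta nu (lp_label Delta) y = x *+ k ->
          kd_val (Phi q) = texp (tensZ y (k%:R^-1)),
        injective Phi &
        range Phi = Stab z].
Proof.
have zeros_free (w : 'rV[R]_n) : (forall i, z 0 i != 0 -> w 0 i = 0) ->
    betaR R phi nu (lp_label Delta) w = 0 -> w = 0.
  (* The inequalities active at the point [p] of the polytope below [z] are
     exactly those indexed by the zeros of [z]. *)
  have [p pE] := level_point z_level => w_supp.
  apply: (labelled_tight_free (p := p) nu_normal Delta_c) => [i|i].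
    by rewrite pE -[leLHS]add0r lerD2r mulr_ge0 ?sqr_ge0 // ltW.
  rewrite /tight pE => not_tight; apply: w_supp; apply: contraNneq not_tight => ->.
  by rewrite ComplexField.Normc.normc0 expr0n mulr0 sub0r.
split; first exact: least_multiple_uniq_lift zeros_free.
have [Phi [PhiE Phi_inj Phi_range]] := torsion_stabilizer_iso phi_bij zeros_free.
exists Phi; split=> // q x k y qx [k_gt0 _ _] y_supp yx.
by apply: (PhiE q x) => //; exact: lifts_fraction.
Qed.
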